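(* Let $\rho$ be a coherent state on $\mathbb{C}^d$ with matrix entries $\rho_{ij}$ in the reference basis. The $l_1$-norm of coherence of $\rho$ cannot be enhanced via a stochastic strictly incoherent operation, i.e. $\max_{\Lambda_s}C_{l_1}(\Lambda_s(\rho))=C_{l_1}(\rho)$, if and only if $$\rho_{ii}=\frac{\sum_{n\neq i}|\rho_{in}|}{C_{l_1}(\rho)}\qquad\text{for every } i\in\{0,1,\dots,d-1\},$$ where $n$ ranges over $\{0,1,\dots,d-1\}\setminus\{i\}$.
   Context: Fix a reference orthonormal basis $\{|i\rangle\}_{i=0}^{d-1}$ of $\mathbb{C}^d$. A state (density operator) is incoherent if it is diagonal in this basis; the set of incoherent states is $\mathcal{I}$; other states are coherent. The $l_1$-norm of coherence of $\rho=\sum_{ij}\rho_{ij}|i\rangle\langle j|$ is $C_{l_1}(\rho)=\sum_{i\neq j}|\rho_{ij}|$. A strictly incoherent operation (SIO) is a completely positive trace-preserving map $\Lambda(\rho)=\sum_{n=1}^N K_n\rho K_n^\dagger$ with $\sum_{n=1}^N K_n^\dagger K_n=I$ such that $K_n\mathcal{I}K_n^\dagger\subset\mathcal{I}$ and $K_n^\dagger\mathcal{I}K_n\subset\mathcal{I}$ for each $n$ (up to normalization, i.e. each $K_n$ and each $K_n^\dagger$ maps diagonal density matrices to diagonal positive semidefinite matrices). A stochastic strictly incoherent operation (sSIO) is a map $$\Lambda_s(\rho)=\frac{\sum_{n=1}^L K_n\rho K_n^\dagger}{\operatorname{Tr}\left(\sum_{n=1}^L K_n\rho K_n^\dagger\right)},$$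 where $\{K_1,\dots,K_L\}$ is a subset of the Kraus operators $K_1,\dots,K_N$ of an SIO (so $\sum_{n=1}^L K_n^\dagger K_n\le I$); it is considered only when the denominator is nonzero. The maximum $\max_{\Lambda_s}$ is over all sSIOs. *)

(* Defs.v *)
From mathcomp Require Import all_boot all_order all_algebra.
From mathcomp Require Import complex.
From mathcomp Require Import classical_sets reals.

Set Implicit Arguments.
Unset Strict Implicit.
Unset Printing Implicit Defensive.

Import Order.TTheory GRing.Theory Num.Theory.

Local Open Scope ring_scope.
Local Open Scope complex_scope.
Local Open Scope sesquilinear_scope.
Local Open Scope classical_set_scope.

Definition complexField (R : realType) : numClosedFieldType := R[i].

(* The definitions below make sense over any numClosedFieldType C, of which
   complexField R is the intended instance. Operators on C^d are matrices in the
   reference basis, and [x <= y] in C means that y - x is real and nonnegative. *)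

(* As the order on C forces v^dagger A v to be real, A is Hermitian. *)
Definition psdmx (C : numClosedFieldType) (d : nat) (A : 'M[C]_d) : Prop :=
  forall v : 'cV[C]_d, 0 <= (v ^t* *m A *m v) 0 0.

Definition density (C : numClosedFieldType) (d : nat) (rho : 'M[C]_d) : Prop :=
  psdmx rho /\ \tr rho = 1.

Definition incoherent (C : numClosedFieldType) (d : nat) (rho : 'M[C]_d) : Prop :=
  density rho /\ is_diag_mx rho.

Definition coherent (C : numClosedFieldType) (d : nat) (rho : 'M[C]_d) : Prop :=
  density rho /\ ~~ is_diag_mx rho.

(* A real number, represented in C. *)
Definition l1_coherence (C : numClosedFieldType) (d : nat) (rho : 'M[C]_d) : C :=
  \sum_i \sum_(j | j != i) `|rho i j|.

(* K delta K^dagger is an incoherent state up to normalization, so its trace is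
   not required to be 1 (it may even vanish). *)
Definition preserves_incoherence (C : numClosedFieldType) (d : nat) (K : 'M[C]_d) :
    Prop :=
  forall delta : 'M[C]_d, incoherent delta ->
    psdmx (K *m delta *m K ^t*) /\ is_diag_mx (K *m delta *m K ^t*).

Definition strictly_incoherent (C : numClosedFieldType) (d : nat) (K : 'M[C]_d) :
    Prop :=
  preserves_incoherence K /\ preserves_incoherence (K ^t*).

Definition SIO_kraus (C : numClosedFieldType) (d N : nat) (K : 'I_N -> 'M[C]_d) :
    Prop :=
  \sum_n (K n) ^t* *m K n = 1%:M /\ forall n, strictly_incoherent (K n).

(* L indexes the Kraus operators retained by the stochastic operation. *)
Definition kraus_sum (C : numClosedFieldType) (d N : nat) (K : 'I_N -> 'M[C]_d)
    (L : {set 'I_N}) (rho : 'M[C]_d) : 'M[C]_d :=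
  \sum_(n in L) K n *m rho *m (K n) ^t*.

Definition stochastic_map (C : numClosedFieldType) (d N : nat) (K : 'I_N -> 'M[C]_d)
    (L : {set 'I_N}) (rho : 'M[C]_d) : 'M[C]_d :=
  (\tr (kraus_sum K L rho))^-1 *: kraus_sum K L rho.

Definition sSIO_coherence_values (C : numClosedFieldType) (d : nat) (rho : 'M[C]_d) :
    set C :=
  [set c | exists (N : nat) (K : 'I_N -> 'M[C]_d) (L : {set 'I_N}),
     [/\ SIO_kraus K, \tr (kraus_sum K L rho) != 0
       & c = l1_coherence (stochastic_map K L rho)]].

Definition is_maximum (C : numClosedFieldType) (S : set C) (m : C) : Prop :=
  S m /\ ubound S m.

(* Main.v *)
(* Every row and column of a strictly incoherent K has at most one nonzero entry,
   so K^dagger K = diag(w) and K scales each off-diagonal |rho_ij| by at most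
   sqrt(w_i w_j) <= (w_i + w_j)/2. Hence the l1-coherence of K rho K^dagger is at
   most sum_i w_i s_i with s_i = sum_(j != i) |rho_ij|, while its trace is
   sum_i w_i rho_ii; if rho_ii = s_i / C_l1(rho), the ratio never exceeds C_l1(rho).
   Conversely, filtering with K = diag(a), 0 < a_i <= 1, shows that maximality forces
   the quadratic form C_l1(rho) sum_i a_i^2 rho_ii - sum_(i != j) a_i a_j |rho_ij| to
   be nonnegative for positive a. It vanishes at a = (1, ..., 1), so its gradient
   there, of entries 2 (C_l1(rho) rho_ii - s_i), is zero. *)
Require Import Defs.
From mathcomp Require Import all_boot all_order all_algebra.
From mathcomp Require Import reals.
From mathcomp Require Import ring.

Set Implicit Arguments.
Unset Strict Implicit.
Unset Printing Implicit Defensive.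

Import Order.TTheory GRing.Theory Num.Theory.

Local Open Scope ring_scope.
Local Open Scope sesquilinear_scope.

(** * Positive semidefinite matrices *)

Lemma adjmxM (C : numClosedFieldType) (m n p : nat) (A : 'M[C]_(m, n))
    (B : 'M[C]_(n, p)) : (A *m B) ^t* = B ^t* *m A ^t*.
Proof. by rewrite trmx_mul map_mxM. Qed.

Lemma mulmx_adjE (C : numClosedFieldType) (m n : nat) (K : 'M[C]_(m, n))
    (A : 'M[C]_n) p q :
  (K *m A *m K ^t*) p q = \sum_i \sum_j K p i * A i j * (K q j)^*.
Proof.
rewrite !mxE exchange_big /=; apply: eq_bigr => j _.
by rewrite !mxE mulr_suml.
Qed.

Lemma psdmx_conj (C : numClosedFieldType) (d : nat) (K A : 'M[C]_d) :
  psdmx A -> psdmx (K *m A *m K ^t*).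
Proof.
move=> hA v; have := hA (K ^t* *m v).
by rewrite adjmxM trmxCK !mulmxA.
Qed.

(** The form of [A] is evaluated at a e_i + b e_j. The case i = j is allowed and yields the diagonal
    entries. *)
Lemma psdmx_quad_ge0 (C : numClosedFieldType) (d : nat) (A : 'M[C]_d) i j
    (a b : C) :
  psdmx A ->
  0 <= a^* * a * A i i + a^* * b * A i j + b^* * a * A j i + b^* * b * A j j.
Proof.
move/(_ (a *: delta_mx i 0 + b *: delta_mx j 0)).
have -> : (a *: delta_mx i 0 + b *: delta_mx j 0 : 'cV[C]_d) ^t* =
    a^* *: delta_mx 0 i + b^* *: delta_mx 0 j.
  apply/matrixP => k l.
  by rewrite !mxE rmorphD !rmorphM !rmorph_nat ![_ && (k == _)]andbC.
rewrite !mulmxDl !mulmxDr -!scalemxAl -!scalemxAr -!rowE -!colE !mxE => h.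
by apply: le_trans h _; rewrite le_eqVlt; apply/orP; left; apply/eqP; ring.
Qed.

Lemma psdmx_diag_ge0 (C : numClosedFieldType) (d : nat) (A : 'M[C]_d) i :
  psdmx A -> 0 <= A i i.
Proof.
move/(psdmx_quad_ge0 i i 1 0).
by rewrite conjC1 conjC0 !(mul0r, mulr0, mul1r, addr0).
Qed.

(** Polarization: testing on e_i + e_j and on e_i + 'i e_j shows that A_ij + A_ji and 'i (A_ij -
    A_ji) are real, and these two facts determine A_ji. *)
Lemma psdmx_conjC (C : numClosedFieldType) (d : nat) (A : 'M[C]_d) i j :
  psdmx A -> A j i = (A i j)^*.
Proof.
move=> hA.
have rd k : A k k \is Num.real by exact/ger0_real/psdmx_diag_ge0.
have h1 := ger0_real (psdmx_quad_ge0 i j 1 1 hA).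
have h2 := ger0_real (psdmx_quad_ge0 i j 1 'i hA).
rewrite conjC1 conjCi !mul1r in h1 h2; rewrite mulr1 in h2.
rewrite (rpredDr _ (rd j)) -addrA (rpredDl _ (rd i)) in h1.
rewrite (mulNr 'i 'i) -expr2 sqrCi opprK mul1r (rpredDr _ (rd j)) -addrA
  (rpredDl _ (rd i)) mulNr -mulrBr in h2.
move/conj_Creal: h1; move/conj_Creal: h2.
rewrite rmorphM rmorphB rmorphD /= conjCi mulNr -mulrN opprB.
move=> /(mulfI (neq0Ci C)) h2 h1.
move: (A i j)^* (A j i)^* h1 h2 => u v h1 h2.
have /(mulfI _) -> // : 2 * A j i = 2 * u; last by rewrite pnatr_eq0.
have -> : 2 * u = u + v - (v - u) by ring.
by rewrite h1 h2; ring.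
Qed.

(** * Structure of strictly incoherent operators *)

Lemma incoherent_delta (C : numClosedFieldType) (d : nat) (i : 'I_d) :
  incoherent (delta_mx i i : 'M[C]_d).
Proof.
split; last first.
  apply/is_diag_mxP => p q; rewrite mxE.
  by case: (eqVneq p i) => [->|_]; rewrite ?mulr0n //= eq_sym val_eqE => /negPf ->.
split; last first.
  rewrite /mxtrace (bigD1 i) //= mxE eqxx big1 ?addr0 // => j /negPf ji.
  by rewrite mxE ji.
move=> v; rewrite -(mul_delta_mx (0 : 'I_1)) !mulmxA -colE -mulmxA -rowE.
by rewrite mxE big_ord1 !mxE mulrC mul_conjC_ge0.
Qed.

(** The image of the basis state |i><i| has entries K_pi (K_qi)^*, and it must be diagonal. *)
Lemma preserves_incoherence_col (C : numClosedFieldType) (d : nat) (K : 'M[C]_d)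
    (p q i : 'I_d) :
  preserves_incoherence K -> p != q -> K p i * (K q i)^* = 0.
Proof.
move=> hK pq; have [_ /is_diag_mxP/(_ p q)] := hK _ (incoherent_delta C i).
rewrite val_eqE => /(_ pq) <-.
rewrite -(mul_delta_mx (0 : 'I_1)) !mulmxA -colE -mulmxA -rowE.
by rewrite mxE big_ord1 !mxE.
Qed.

Lemma strictly_incoherent_col (C : numClosedFieldType) (d : nat) (K : 'M[C]_d)
    (p q i : 'I_d) :
  strictly_incoherent K -> p != q -> `|K p i| * `|K q i| = 0.
Proof.
move=> [hK _] pq.
by rewrite -(norm_conjC (K q i)) -normrM preserves_incoherence_col ?normr0.
Qed.

Lemma strictly_incoherent_gram (C : numClosedFieldType) (d : nat) (K : 'M[C]_d)
    (i j : 'I_d) :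
  strictly_incoherent K -> i != j -> (K ^t* *m K) i j = 0.
Proof.
move=> [_ hK] ij; rewrite mxE big1 // => p _.
by have := preserves_incoherence_col p hK ij; rewrite !mxE conjCK.
Qed.

Lemma strictly_incoherent_diag (C : numClosedFieldType) (d : nat) (a : 'rV[C]_d) :
  strictly_incoherent (diag_mx a).
Proof.
have pres (b : 'rV[C]_d) : preserves_incoherence (diag_mx b).
  move=> delta [[hp _] /diag_mxP[e de]]; split; first exact: psdmx_conj.
  by rewrite de tr_diag_mx map_diag_mx !mulmx_diag diag_mx_is_diag.
by split; rewrite ?tr_diag_mx ?map_diag_mx.
Qed.

(** * Trace and l1-coherence after one Kraus operator *)

Lemma trace_kraus (C : numClosedFieldType) (d : nat) (K A : 'M[C]_d) :
  strictly_incoherent K ->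
  \tr (K *m A *m K ^t*) = \sum_i (K ^t* *m K) i i * A i i.
Proof.
move=> hK; rewrite mxtrace_mulC mulmxA; apply: eq_bigr => i _.
rewrite mxE (bigD1 i) //= big1 ?addr0 // => j ji.
by rewrite strictly_incoherent_gram ?mul0r // eq_sym.
Qed.

(** Cross terms vanish because a column has at most one nonzero entry. The column sum thus plays the
    role of sqrt(w_i) without locating that entry. *)
Lemma gram_norm_sum (C : numClosedFieldType) (d : nat) (K : 'M[C]_d) i :
  strictly_incoherent K -> (\sum_p `|K p i|) ^+ 2 = (K ^t* *m K) i i.
Proof.
move=> hK; rewrite expr2 mulr_suml mxE; apply: eq_bigr => p _.
rewrite mulr_sumr (bigD1 p) //= big1 ?addr0 => [|q qp].
  by rewrite !mxE -normCKC expr2.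
by rewrite strictly_incoherent_col // eq_sym.
Qed.

Lemma l1_coherence_kraus (C : numClosedFieldType) (d : nat) (K A : 'M[C]_d) :
  strictly_incoherent K -> psdmx A ->
  l1_coherence (K *m A *m K ^t*) <=
    \sum_i (K ^t* *m K) i i * \sum_(j | j != i) `|A i j|.
Proof.
move=> hK hA; pose c i : C := \sum_p `|K p i|.
have c_ge0 i : 0 <= c i by exact: sumr_ge0.
have entry p q : p != q -> `|(K *m A *m K ^t*) p q| <=
    \sum_i \sum_(j | j != i) `|K p i| * `|A i j| * `|K q j|.
  move=> pq; rewrite mulmx_adjE; apply: le_trans (ler_norm_sum _ _ _) _.
  apply: ler_sum => i _; apply: le_trans (ler_norm_sum _ _ _) _.
  (* The term j = i contains two distinct entries of column i, so it vanishes: diagonal entries of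
     [A] create no coherence. *)
  rewrite (bigD1 i) //= !normrM norm_conjC mulrAC strictly_incoherent_col //.
  by rewrite mul0r add0r; apply: ler_sum => j _; rewrite !normrM norm_conjC.
apply: (@le_trans _ _ (\sum_i \sum_(j | j != i) `|A i j| * (c i * c j))).
  (* Adding the nonnegative terms with p = q lets the sums over p and q factor into [c i * c j]. *)
  apply: (@le_trans _ _ (\sum_p \sum_q
      \sum_i \sum_(j | j != i) `|K p i| * `|A i j| * `|K q j|)).
    apply: ler_sum => p _; rewrite big_mkcond; apply: ler_sum => q _.
    case: ifP => [qp|_]; first by apply: entry; rewrite eq_sym.
    by do 2![apply: sumr_ge0 => ? _]; rewrite !mulr_ge0.
  rewrite le_eqVlt; apply/orP; left; apply/eqP.
  under eq_bigr do rewrite exchange_big /=.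
  rewrite exchange_big /=; apply: eq_bigr => i _.
  under eq_bigr do rewrite exchange_big /=.
  rewrite exchange_big /=; apply: eq_bigr => j _.
  rewrite mulrCA mulr_suml; apply: eq_bigr => p _.
  by rewrite !mulr_sumr; apply: eq_bigr => q _; rewrite mulrA.
pose w i := (K ^t* *m K) i i.
have cE i : c i ^+ 2 = w i by exact: gram_norm_sum.
(* Since |A_ij| = |A_ji|, both halves of the mean (w_i + w_j)/2 contribute equally. *)
have sym : \sum_i \sum_(j | j != i) `|A i j| * w j =
           \sum_i \sum_(j | j != i) `|A i j| * w i.
  rewrite (exchange_big_dep predT) //=; apply: eq_bigr => i _.
  apply: eq_big => [j|j _]; first by rewrite eq_sym.
  by rewrite (psdmx_conjC i j) // norm_conjC.
apply: (@le_trans _ _ (\sum_i \sum_(j | j != i) `|A i j| * ((w i + w j) / 2))).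
  do 2![apply: ler_sum => ? _]; rewrite ler_wpM2l // -!cE.
  by rewrite real_leif_mean_square ?ger0_real.
rewrite le_eqVlt; apply/orP; left; apply/eqP.
under eq_bigr do under eq_bigr do rewrite mulrA mulrDr mulrDl.
under eq_bigr do rewrite big_split -!mulr_suml.
rewrite big_split /= -!mulr_suml sym.
under [X in _ + X / 2]eq_bigr do rewrite -mulr_suml.
rewrite -splitr.
by apply: eq_bigr => i _; rewrite mulrC.
Qed.

(** * The l1-coherence as a seminorm *)

Lemma l1_coherence_ge0 (C : numClosedFieldType) (d : nat) (A : 'M[C]_d) :
  0 <= l1_coherence A.
Proof. by do 2![apply: sumr_ge0 => ? _]. Qed.

Lemma l1_coherenceZ (C : numClosedFieldType) (d : nat) (a : C) (A : 'M[C]_d) :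
  l1_coherence (a *: A) = `|a| * l1_coherence A.
Proof.
rewrite /l1_coherence mulr_sumr; apply: eq_bigr => i _; rewrite mulr_sumr.
by apply: eq_bigr => j _; rewrite mxE normrM.
Qed.

Lemma l1_coherence_sum (C : numClosedFieldType) (d : nat) (I : finType)
    (P : pred I) (F : I -> 'M[C]_d) :
  l1_coherence (\sum_(n | P n) F n) <= \sum_(n | P n) l1_coherence (F n).
Proof.
rewrite /l1_coherence exchange_big /=; apply: ler_sum => i _.
rewrite exchange_big /=; apply: ler_sum => j _.
by rewrite summxE ler_norm_sum.
Qed.

Lemma l1_coherence_gt0 (C : numClosedFieldType) (d : nat) (A : 'M[C]_d) :
  ~~ is_diag_mx A -> 0 < l1_coherence A.
Proof.
move=> hA; rewrite lt_def l1_coherence_ge0 andbT.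
apply: contra hA => /eqP h; apply/is_diag_mxP => i j ij.
have row0 : \sum_(k | k != i) `|A i k| = 0.
  by apply: (psumr_eq0P _ h) => // k _; exact: sumr_ge0.
apply: normr0_eq0; apply: (psumr_eq0P _ row0) => //.
by rewrite eq_sym -val_eqE.
Qed.

(** * Sufficiency: upper bound and attainment *)

Lemma sSIO_l1_le (C : numClosedFieldType) (d : nat) (rho : 'M[C]_d) :
  coherent rho ->
  (forall i, rho i i = (\sum_(j | j != i) `|rho i j|) / l1_coherence rho) ->
  classical_sets.ubound (sSIO_coherence_values rho) (l1_coherence rho).
Proof.
move=> [[hp _] /l1_coherence_gt0 l1_gt0] hrho _ [N [K [L [[_ hK] tr0 ->]]]].
have tr_ge0 : 0 <= \tr (kraus_sum K L rho).
  rewrite /kraus_sum raddf_sum /=; apply: sumr_ge0 => n _; apply: sumr_ge0 => i _.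
  exact/psdmx_diag_ge0/psdmx_conj.
have tr_gt0 : 0 < \tr (kraus_sum K L rho) by rewrite lt_def tr0.
rewrite l1_coherenceZ ger0_norm ?invr_ge0 // mulrC ler_pdivrMr //.
apply: le_trans (l1_coherence_sum _ _) _.
rewrite /kraus_sum raddf_sum mulr_sumr /=; apply: ler_sum => n _.
apply: le_trans (l1_coherence_kraus (hK n) hp) _.
(* The hypothesis reads s_i = C_l1(rho) rho_ii, so the two sums agree term by term. *)
rewrite trace_kraus // mulr_sumr le_eqVlt; apply/orP; left; apply/eqP.
apply: eq_bigr => i _.
by rewrite mulrCA hrho [_ * (_ / _)]mulrC divfK // gt_eqF.
Qed.

(** The witness is the identity channel, with its only Kraus operator retained. *)
Lemma sSIO_l1_attained (C : numClosedFieldType) (d : nat) (rho : 'M[C]_d) :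
  density rho -> sSIO_coherence_values rho (l1_coherence rho).
Proof.
move=> [_ tr1]; exists 1%N, (fun=> 1%:M), [set: 'I_1].
have E : kraus_sum (fun=> 1%:M) [set: 'I_1] rho = rho.
  by rewrite /kraus_sum big_mkcond big_ord1 in_setT mul1mx trmx1 map_mx1 mulmx1.
split; last by rewrite /stochastic_map E tr1 invr1 scale1r.
- split=> [|_]; first by rewrite big_ord1 trmx1 map_mx1 mulmx1.
  by rewrite -diag_const_mx; exact: strictly_incoherent_diag.
- by rewrite E tr1 oner_eq0.
Qed.

(** * Necessity: diagonal filters *)

Lemma diag_filter_le (C : numClosedFieldType) (d : nat) (rho : 'M[C]_d)
    (a : 'I_d -> C) :
  density rho ->
  classical_sets.ubound (sSIO_coherence_values rho) (l1_coherence rho) ->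
  (forall i, 0 < a i <= 1) ->
  \sum_i \sum_(j | j != i) a i * a j * `|rho i j| <=
    l1_coherence rho * \sum_i a i ^+ 2 * rho i i.
Proof.
move=> [hp tr1] hub ha.
have a_ge0 i : 0 <= a i by case/andP: (ha i) => /ltW.
have a_norm i : `|a i| = a i by rewrite ger0_norm.
have a_conj i : (a i)^* = a i by rewrite conj_Creal ?ger0_real.
(* The discarded operator diag(b) completes diag(a) to an SIO. *)
pose b i := sqrtC (1 - a i ^+ 2).
have b_conj i : (b i)^* = b i.
  rewrite conj_Creal ?ger0_real // sqrtC_ge0 subr_ge0 expr_le1 //.
  by case/andP: (ha i).
pose K (n : 'I_2) : 'M[C]_d := diag_mx (\row_i (if n == 0 then a i else b i)).
have K_SIO : SIO_kraus K.
  split=> [|n]; last exact: strictly_incoherent_diag.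
  rewrite big_ord_recl big_ord1 !tr_diag_mx !map_diag_mx !mulmx_diag -raddfD /=.
  rewrite -diag_const_mx; congr diag_mx; apply/rowP => i; rewrite !mxE /=.
  by rewrite a_conj b_conj -!expr2 sqrtCK addrC subrK.
pose L := [set 0 : 'I_2]; set S := kraus_sum K L rho.
have SE i j : S i j = a i * a j * rho i j.
  rewrite /S /kraus_sum big_set1 tr_diag_mx map_diag_mx mul_mx_diag mul_diag_mx.
  by rewrite !mxE /= a_conj mulrAC.
have trS : \tr S = \sum_i a i ^+ 2 * rho i i.
  by apply: eq_bigr => i _; rewrite SE.
have term_ge0 i : 0 <= a i ^+ 2 * rho i i.
  by rewrite mulr_ge0 ?exprn_ge0 ?psdmx_diag_ge0.
(* As every a_i is positive, a zero trace would force every rho_ii to vanish, against trace 1. *)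
have trS_neq0 : \tr S != 0.
  rewrite trS; apply/eqP => h.
  have : \tr rho != 0 by rewrite tr1 oner_eq0.
  rewrite /mxtrace big1 ?eqxx // => i _.
  have /eqP : a i ^+ 2 * rho i i = 0.
    by apply: (psumr_eq0P _ h) => // j _; exact: term_ge0.
  by rewrite mulf_eq0 expf_eq0 gt_eqF /= => [/eqP|]; last by case/andP: (ha i).
have trS_gt0 : 0 < \tr S by rewrite lt_def trS_neq0 trS sumr_ge0.
have := hub _ (ex_intro _ 2 (ex_intro _ K (ex_intro _ L
  (And3 K_SIO trS_neq0 erefl)))).
rewrite l1_coherenceZ -/S gtr0_norm ?invr_gt0 // mulrC ler_pdivrMr // trS.
apply: le_trans; rewrite le_eqVlt; apply/orP; left; apply/eqP.
by do 2![apply: eq_bigr => ? _]; rewrite SE !normrM !a_norm.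
Qed.

(** The gradient argument becomes algebraic: only coordinate i of the all-ones filter is perturbed,
    by one explicit t, so no limit is taken. *)
Lemma sSIO_l1_le_inv (C : numClosedFieldType) (d : nat) (rho : 'M[C]_d) i :
  coherent rho ->
  classical_sets.ubound (sSIO_coherence_values rho) (l1_coherence rho) ->
  rho i i = (\sum_(j | j != i) `|rho i j|) / l1_coherence rho.
Proof.
move=> [hrho /l1_coherence_gt0 l1_gt0] hub; have [hp tr1] := hrho.
set c := l1_coherence rho in l1_gt0 *; set s := \sum_(j | _) _.
pose y := c * rho i i; pose x := y - s.
have y_ge0 : 0 <= y by rewrite mulr_ge0 ?psdmx_diag_ge0 ?ltW.
have x_real : x \is Num.real by rewrite rpredB ?ger0_real ?sumr_ge0.
pose D := 1 + `|x| + y.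
have D_gt0 : 0 < D by rewrite /D -addrA ltr_pwDl ?addr_ge0.
(* With this t, |t| < 1 and 2 t x + t^2 y < 0 unless x = 0. *)
have [t tE] : {t | t = - x / D} by exists (- x / D).
have t_real : t \is Num.real.
  by rewrite tE realM ?realN ?realV // gtr0_real.
have t_norm : `|t| < 1.
  rewrite tE normrM normrN normfV (gtr0_norm D_gt0) ltr_pdivrMr // mul1r.
  by rewrite /D addrAC ltrDr ltr_pwDl.
(* Halving leaves room for 1 + t > 1 in a sub-normalized filter. *)
pose a j : C := (1 + (j == i)%:R * t) / 2.
have ha j : 0 < a j <= 1.
  move: t_norm; rewrite real_ltr_norml // => /andP[t_gt t_lt].
  rewrite divr_gt0 ?ltr0n // ?ler_pdivrMr ?ltr0n // ?mul1r.
    by case: eqP; rewrite ?mul1r ?mul0r ?lerD2l ?ler01 ?ltW.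
  by case: eqP; rewrite ?mul1r ?mul0r ?addr0 ?ltr01 // -ltrBlDl sub0r.
have := diag_filter_le hrho hub ha.
have quad : \sum_j a j ^+ 2 * rho j j = (1 + (2 * t + t ^+ 2) * rho i i) / 4.
  have tail : \sum_(j | j != i) rho j j = 1 - rho i i.
    by rewrite -tr1 /mxtrace [X in X - _](bigD1 i) //= addrAC subrr add0r.
  rewrite (bigD1 i) //= /a eqxx.
  have -> : \sum_(j | j != i) ((1 + (j == i)%:R * t) / 2) ^+ 2 * rho j j =
      (\sum_(j | j != i) rho j j) / 4.
    by rewrite mulr_suml; apply: eq_bigr => j /negPf -> /=; field.
  by rewrite tail /=; field.
have bil : \sum_j \sum_(k | k != j) a j * a k * `|rho j k| = (c + 2 * t * s) / 4.
  (* No t^2 term appears: j and k differ, so at most one of them equals i. *)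
  have aa j k : k != j -> a j * a k * `|rho j k| =
      (`|rho j k| + t * ((j == i)%:R * `|rho j k|) +
       t * ((k == i)%:R * `|rho j k|)) / 4.
    by rewrite /a; case: (eqVneq j i) => [->|ji]; case: (eqVneq k i) => [->|ki];
      rewrite ?eqxx // => kj /=; field.
  under eq_bigr do under eq_bigr do rewrite aa //.
  under eq_bigr do rewrite -mulr_suml !big_split -!mulr_sumr /=.
  rewrite -mulr_suml !big_split -!mulr_sumr /=.
  have -> : \sum_j (j == i)%:R * \sum_(k | k != j) `|rho j k| = s.
    rewrite (bigD1 i) //= eqxx mul1r [X in _ + X]big1 ?addr0 // => j /negPf ->.
    by rewrite mul0r.
  (* This is the sum over column i, equal to the row sum [s] because [rho] is Hermitian. *)
  have -> : \sum_j \sum_(k | k != j) (k == i)%:R * `|rho j k| = s.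
    rewrite (exchange_big_dep predT) //= (bigD1 i) //=.
    rewrite [X in _ + X]big1 ?addr0 => [|k /negPf ->].
      apply: eq_big => [j|j _]; first by rewrite eq_sym.
      by rewrite eqxx mul1r (psdmx_conjC i j) // norm_conjC.
    by rewrite big1 // => j _; rewrite mul0r.
  by rewrite -/(l1_coherence rho) -/c; field.
(* The common factor 1/4 and the common value [c] at t = 0 cancel. *)
rewrite quad bil mulrA ler_pM2r ?invr_gt0 ?ltr0n // mulrDr mulr1 lerD2l.
rewrite -subr_ge0.
(* Substituting t = -x/D in 2 t x + t^2 y isolates a square times y - 2 D, which is negative since D
   > y. Nonnegativity then forces x = 0. *)
have -> : c * ((2 * t + t ^+ 2) * rho i i) - 2 * t * s =
    (x / D) ^+ 2 * (y - 2 * D).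
  have -> : c * ((2 * t + t ^+ 2) * rho i i) - 2 * t * s =
      2 * t * x + t ^+ 2 * y.
    by rewrite /x /y; ring.
  by rewrite tE; field; rewrite gt_eqF.
have yD_lt0 : y - 2 * D < 0.
  have -> : y - 2 * D = - (D + (1 + `|x|)) by rewrite /D; ring.
  by rewrite oppr_lt0 addr_gt0 // ltr_pwDl.
rewrite nmulr_lge0 // => xD_le0.
have /eqP : (x / D) ^+ 2 = 0.
  apply/eqP; rewrite eq_le xD_le0 real_exprn_even_ge0 //.
  by rewrite realM ?realV // gtr0_real.
rewrite expf_eq0 /= mulf_eq0 invr_eq0 (gt_eqF D_gt0) orbF subr_eq0 => /eqP <-.
by rewrite /y mulrC mulKf // gt_eqF.
Qed.

Theorem theorem2 (R : realType) (d : nat) (rho : 'M[complexField R]_d)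
    (hrho : coherent rho) :
  is_maximum (sSIO_coherence_values rho) (l1_coherence rho) <->
  (forall i : 'I_d,
     rho i i = (\sum_(n < d | n != i) `|rho i n|) / l1_coherence rho).
Proof.
split=> [[_ hub] i | h]; first exact: sSIO_l1_le_inv.
by split; [apply: sSIO_l1_attained; case: hrho | exact: sSIO_l1_le].
Qed.
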